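(* Assume $\theta_i<1$ for all $i$ and $\theta_j>0$ for some $j$. Then: (i) systems (A) and (B) have at least one equilibrium, and every equilibrium social power $x^*$ (i.e. every fixed point of $F$, equivalently the $x$-component of every equilibrium of (B)) satisfies: (a) $x^*\in\operatorname{int}\Delta_n$; (b) $x^*_i\ge 1/n$ for every $i\in\mathcal V_f$, and for $i\in\mathcal V_f$ one has $x^*_i=1/n$ if and only if $C_{ji}=0$ for all $j\in\mathcal V_p$; (c) $x^*_i>(1-\theta_i)/n$ for every $i\in\mathcal V_p$, and for $i\in\mathcal V_p$, if $C_{ji}=0$ for all $j\in\mathcal V_p$ then $x^*_i<1/n$; (d) $\max_i x^*_i<1/n+\theta_{\mathrm{ave}}$. (ii) If $\theta_{\max}<\dfrac{n}{n+2(1+\zeta)}$ with $\zeta=n\theta_{\mathrm{ave}}-\theta_{\min}$, then the equilibrium social power $x^*$ of systems (A) and (B) is unique.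
   Context: Let $n\ge 2$, $\mathbf 1_n$ the all-ones vector, $I_n$ the identity matrix, $\Delta_n=\{x\in\mathbb R^n: x\ge 0,\ \mathbf 1_n^Tx=1\}$, $\operatorname{int}\Delta_n=\{x\in\mathbb R^n: x>0,\ \mathbf 1_n^Tx=1\}$. Let $C\in\mathbb R^{n\times n}$ be a nonnegative row-stochastic matrix with zero diagonal, $\theta=(\theta_1,\dots,\theta_n)\in[0,1]^n$, $\Theta=\mathrm{diag}(\theta)$, and for $x\in\mathbb R^n$, $W(x)=\mathrm{diag}(x)+(I_n-\mathrm{diag}(x))C$. Let $\theta_{\min}=\min_j\theta_j$, $\theta_{\mathrm{ave}}=\frac1n\sum_j\theta_j$, $\theta_{\max}=\max_j\theta_j$. Let $\mathcal V_f=\{i:\theta_i=0\}$ (fully stubborn individuals) and $\mathcal V_p=\{i:\theta_i>0\}$ (partially stubborn individuals). System (A): $x(s+1)=F(x(s))$, $x(0)\in\Delta_n$, where $F(x)=(I_n-\Theta)(I_n-W(x)^T\Theta)^{-1}\mathbf 1_n/n$; an equilibrium is $x^*\in\Delta_n$ with $F(x^* )=x^*$. System (B): $V(k+1)=\Theta W(x(k))V(k)+I_n-\Theta$, $x(k+1)=V(k+1)^T\mathbf 1_n/n$, with $V(0)=I_n$, $x(0)\in\Delta_n$; an equilibrium is a pair $(V^*,x^* )$ with $V^*$ row-stochastic, $x^*\in\Delta_n$, $V^*=\Theta W(x^* )V^*+I_n-\Theta$, $x^*=(V^* )^T\mathbf 1_n/n$; $x^*$ is then called its equilibrium social power. *)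

(* Defs.v *)
From HB Require Import structures.
From mathcomp Require Import all_boot all_order all_algebra.
Set Implicit Arguments. Unset Strict Implicit. Unset Printing Implicit Defensive.
Import Order.TTheory GRing.Theory Num.Theory.
Local Open Scope ring_scope.

Section Defs.
Variables (R : rcfType) (n : nat).

Definition nonneg_mx (A : 'M[R]_n) : Prop := forall i j, 0 <= A i j.
Definition row_stochastic (A : 'M[R]_n) : Prop :=
  nonneg_mx A /\ forall i, \sum_j A i j = 1.
Definition zero_diag (A : 'M[R]_n) : Prop := forall i, A i i = 0.

Definition in_simplex (x : 'cV[R]_n) : Prop :=
  (forall i, 0 <= x i 0) /\ \sum_i x i 0 = 1.
Definition in_int_simplex (x : 'cV[R]_n) : Prop :=
  (forall i, 0 < x i 0) /\ \sum_i x i 0 = 1.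

Definition Theta (theta : 'I_n -> R) : 'M[R]_n := diag_mx (\row_i theta i).

Definition Wmx (C : 'M[R]_n) (x : 'cV[R]_n) : 'M[R]_n :=
  diag_mx x^T + (1%:M - diag_mx x^T) *m C.

Definition unif : 'cV[R]_n := const_mx (n%:R^-1).

Definition Fmap (C : 'M[R]_n) (theta : 'I_n -> R) (x : 'cV[R]_n) : 'cV[R]_n :=
  (1%:M - Theta theta) *m invmx (1%:M - (Wmx C x)^T *m Theta theta) *m unif.

Definition equilibriumA C theta (x : 'cV[R]_n) : Prop :=
  in_simplex x /\ Fmap C theta x = x.

Definition equilibriumB C theta (V : 'M[R]_n) (x : 'cV[R]_n) : Prop :=
  row_stochastic V /\ in_simplex x /\
  V = Theta theta *m Wmx C x *m V + 1%:M - Theta theta /\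
  x = V^T *m unif.

Definition theta_min (theta : 'I_n -> R) : R := \big[Num.min/1]_i theta i.
Definition theta_max (theta : 'I_n -> R) : R := \big[Num.max/0]_i theta i.
Definition theta_ave (theta : 'I_n -> R) : R := n%:R^-1 * \sum_i theta i.

End Defs.

(* Main.v *)
Require Import Defs.
From HB Require Import structures.
From mathcomp Require Import all_boot all_order all_algebra.
From mathcomp Require Import ring lra.
From mathcomp Require Import polyrcf ordered_qelim qe_rcf.
Set Implicit Arguments. Unset Strict Implicit. Unset Printing Implicit Defensive.
Import Order.TTheory GRing.Theory Num.Theory.
Local Open Scope ring_scope.

(** With [a i = theta i / (1 - theta i)] and [h i t = a i * t * (1 - t)], the fixed points of
    [F] in the simplex are the solutions of
    [x i + h i (x i) = 1/n + \sum_j C j i * h j (x j)], whose coordinates sum to 1 as soon as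
    the equations hold.  The bounds (a)-(d) and, through a 1-norm contraction, uniqueness are
    read off this system.

    Existence over an arbitrary real closed field replaces Brouwer's theorem by Knaster and
    Tarski's.  On [0, 1/2] all [h i] increase, so the system truncated at 1/2 is monotone and
    the coordinatewise infimum of its supersolutions is a solution; the infima exist because,
    by quantifier elimination, the supersolutions project to finite unions of intervals.
    Since the coordinates sum to 1, at most one coordinate [k] is truncated; then eliminating
    [x k = 1 - \sum_(j != k) x j] gives another monotone system in the remaining ones. *)

(** * Definable subsets of the line and their infima *)

Section Semialgebraic.
Variable R : rcfType.
Implicit Types (e : seq R) (f : ord.formula R) (t : GRing.term R).

Lemma rterm_horner e i t : GRing.rterm t ->
  exists p : {poly R}, forall x, p.[x] = GRing.eval (set_nth 0 e i x) t.
Proof.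
elim: t => //=.
- move=> j _; case: (eqVneq j i) => [->|ne].
    by exists 'X => x; rewrite hornerX nth_set_nth /= eqxx.
  by exists (e`_j)%:P => x; rewrite hornerC nth_set_nth /= (negPf ne).
- by move=> c _; exists c%:P => x; rewrite hornerC.
- by move=> c _; exists (c%:R)%:P => x; rewrite hornerC.
- move=> t1 IH1 t2 IH2 /andP[/IH1[p hp] /IH2[q hq]].
  by exists (p + q) => x; rewrite hornerD hp hq.
- by move=> t1 IH1 /IH1[p hp]; exists (- p) => x; rewrite hornerN hp.
- by move=> t1 IH1 k /IH1[p hp]; exists (p *+ k) => x; rewrite hornerMn hp.
- move=> t1 IH1 t2 IH2 /andP[/IH1[p hp] /IH2[q hq]].
  by exists (p * q) => x; rewrite hornerM hp hq.
- by move=> t1 IH1 k /IH1[p hp]; exists (p ^+ k) => x; rewrite horner_exp hp.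
Qed.

(** Encodes a finite union of intervals without sorting endpoints: [b] can change value only at
    points of the finite list [Z], and enlarging [Z] is harmless. *)
Definition switches_in (Z : seq R) (b : R -> bool) :=
  forall x y, x <= y -> (forall z, z \in Z -> ~~ (x <= z <= y)) -> b x = b y.

Lemma poly_sgr_switches (p : {poly R}) x y : x <= y ->
  (forall z, z \in rootsR p -> ~~ (x <= z <= y)) -> Num.sg p.[x] = Num.sg p.[y].
Proof.
move=> lexy hZ; case: (eqVneq p 0) => [->|p0]; first by rewrite !horner0.
apply: (@polyrN0_itv _ `[x, y]%R); rewrite ?in_itv /= ?lexx ?lexy //.
move=> z /= hz; apply/negP => rz.
have /hZ : z \in rootsR p by rewrite -roots_on_rootsR ?inE.
by move: hz; rewrite in_itv /= => ->.
Qed.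

Lemma qf_switches e i f : ord.qf_form f -> ord.rformula f ->
  exists Z, switches_in Z (fun x => ord.qf_eval (set_nth 0 e i x) f).
Proof.
(* The three kinds of atoms are all tests [P] on the sign of a difference of two polynomials. *)
have cmp t1 t2 (P : R -> bool) : GRing.rterm t1 && GRing.rterm t2 ->
    exists Z, switches_in Z (fun x => P (Num.sg
       (GRing.eval (set_nth 0 e i x) t1 - GRing.eval (set_nth 0 e i x) t2))).
  case/andP=> /(rterm_horner e i)[p hp] /(rterm_horner e i)[q hq].
  exists (rootsR (p - q)) => x y lexy hZ; congr P.
  by rewrite -!hp -!hq -!hornerN -!hornerD; apply: poly_sgr_switches.
have cat (op : bool -> bool -> bool) (b c : R -> bool) Y Z :
    switches_in Y b -> switches_in Z c ->
    switches_in (Y ++ Z) (fun x => op (b x) (c x)).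
  move=> hY hZ x y lexy h; congr op; [apply: hY|apply: hZ] => // z hz;
    by apply: h; rewrite mem_cat hz ?orbT.
elim: f => //=.
- by move=> b; exists [::].
- move=> t1 t2 _ /(cmp _ _ (fun s => s == 0))[Z hZ]; exists Z => x y lexy h.
  by have := hZ x y lexy h; rewrite /= !sgr_eq0 !subr_eq0.
- move=> t1 t2 _ /(cmp _ _ (fun s => s < 0))[Z hZ]; exists Z => x y lexy h.
  by have := hZ x y lexy h; rewrite /= !sgr_lt0 !subr_lt0.
- move=> t1 t2 _ /(cmp _ _ (fun s => s <= 0))[Z hZ]; exists Z => x y lexy h.
  by have := hZ x y lexy h; rewrite /= !sgr_le0 !subr_le0.
- move=> f1 IH1 f2 IH2 /andP[q1 q2] /andP[r1 r2].
  by have [Y hY] := IH1 q1 r1; have [Z hZ] := IH2 q2 r2; exists (Y ++ Z); apply: cat.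
- move=> f1 IH1 f2 IH2 /andP[q1 q2] /andP[r1 r2].
  by have [Y hY] := IH1 q1 r1; have [Z hZ] := IH2 q2 r2; exists (Y ++ Z); apply: cat.
- move=> f1 IH1 f2 IH2 /andP[q1 q2] /andP[r1 r2].
  by have [Y hY] := IH1 q1 r1; have [Z hZ] := IH2 q2 r2; exists (Y ++ Z);
     apply: (cat implb).
- move=> f1 IH1 q1 r1; have [Y hY] := IH1 q1 r1; exists Y => x y lexy h.
  by congr negb; apply: hY.
Qed.

Lemma holds_switches e i f : exists (Z : seq R) (b : R -> bool),
  switches_in Z b /\ forall x, b x <-> ord.holds (set_nth 0 e i x) f.
Proof.
set g := ord.quantifier_elim (@wproj R) (ord.to_rform f).
have /andP[qg rg] : ord.qf_form g && ord.rformula g.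
  exact: (ord.quantifier_elim_wf (@wf_QE_wproj R)) (ord.to_rform_rformula f).
have [Z hZ] := qf_switches e i qg rg.
exists Z, (fun x => ord.qf_eval (set_nth 0 e i x) g); split=> // x.
apply: iff_sym; apply: rwP.
exact: (ord.proj_satP (@wf_QE_wproj R) (@valid_QE_wproj R)).
Qed.

(** The infimum is [m], the largest lower bound among [b] and the switching points [Z]. If [m + eps]
    were still a lower bound, some [t] in [A] would have no point of [Z] between [m + eps / 2] and
    itself, forcing [m + eps / 2] into [A]. *)
Lemma definable_inf e i f (A := fun x => ord.holds (set_nth 0 e i x) f) a b :
  A a -> (forall x, A x -> b <= x) ->
  exists m, (forall x, A x -> m <= x) /\
    (forall eps, 0 < eps -> exists x, A x /\ x < m + eps).
Proof.
move=> Aa lbb; have [Z [B [swB BP]]] := holds_switches e i f.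
(* Having an element of [A] below [c] is itself a formula, hence decidable by [rcf_sat]; this allows
   [Z] to be filtered by [lower]. *)
pose below c := ord.Exists i (ord.And f (ord.Lt (GRing.Var R i) (GRing.Const c))).
have ltP c : reflect (exists x, A x /\ x < c)
    (rcf_sat e (below c)).
  apply: (iffP (rcf_satP _ _)) => /= -[x]; rewrite ?nth_set_nth /= ?eqxx => -[? ?];
    by exists x; rewrite ?nth_set_nth /= ?eqxx.
pose lower c := ~~ rcf_sat e (below c).
have lowerP c : lower c -> forall x, A x -> c <= x.
  by move=> /ltP h x Ax; case: (lerP c x) => // xc; case: h; exists x.
pose m := \big[Num.max/b]_(z <- Z | lower z) z.
have lbm : forall x, A x -> m <= x.
  move=> x Ax; rewrite /m; apply: (big_rec (fun u => u <= x)) => [|z u lz hu]; first exact: lbb.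
  by rewrite ge_max hu (lowerP z lz).
exists m; split=> // eps eps0.
case: (ltP (m + eps)) => // nex; exfalso.
have lbe x : A x -> m + eps <= x.
  by move=> Ax; case: (lerP (m + eps) x) => // lx; case: nex; exists x.
(* Each point of [Z] that is not a lower bound lies above some element of [A]; [t] is the least of
   [a] and the elements so found. *)
have [t At ht] : exists2 t, A t & forall z, z \in Z -> (z <= m) || (t < z).
  have hm z : z \in Z -> lower z -> z <= m.
    move=> zZ lz; rewrite /m; elim: (Z) zZ => //= y s IH.
    rewrite inE big_cons => /predU1P[<-|/IH h]; first by rewrite lz le_max lexx.
    by case: ifP => // _; rewrite le_max h orbT.
  have : {subset Z <= Z} by [].
  elim: {1 3}Z => [|z s IH] sub; first by exists a.
  have [|t At ht] := IH; first by move=> y ys; apply: sub; rewrite inE ys orbT.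
  have zZ : z \in Z by apply: sub; rewrite mem_head.
  case: (boolP (lower z)) => [lz|/negPn/ltP[u [Au uz]]].
    by exists t => // y /predU1P[->|/ht //]; rewrite hm.
  exists (Num.min u t); first by case: (lerP u t).
  move=> y /predU1P[->|/ht /orP[->//|ty]]; first by rewrite gt_min uz orbT.
  by rewrite gt_min ty !orbT.
have let_ := lbe t At.
have Bh : B (m + eps / 2) = B t.
  apply: swB => [|z zZ]; first lra.
  by apply/negP => /andP[h1 h2]; case/orP: (ht z zZ) => h3; lra.
have /BP Ah : B (m + eps / 2) by rewrite Bh; apply/BP.
by have := lbe _ Ah; lra.
Qed.

Lemma holds_foldExists s e f :
  ord.holds e (foldr ord.Exists f s) <->
  exists e', (forall j, j \notin s -> e'`_j = e`_j) /\ ord.holds e' f.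
Proof.
elim: s e => [|i s IH] e /=.
  split=> [h|[e' [he h]]]; first by exists e.
  by apply: ord.eq_holds h => j; apply: he.
split=> [[x /IH[e' [he h]]]|[e' [he h]]].
  exists e'; split=> // j; rewrite inE negb_or => /andP[ji js].
  by rewrite he // nth_set_nth /= (negPf ji).
exists e'`_i; apply/IH; exists e'; split=> // j js.
rewrite nth_set_nth /=; case: (eqVneq j i) => [->//|ji].
by apply: he; rewrite inE negb_or ji.
Qed.

(** * Semialgebraic sets of vectors *)

Variable n : nat.

(** Only the first [n] entries count and missing ones read as 0, so many environments stand for one
    vector. *)
Definition env_col e : 'cV[R]_n := \col_(i < n) e`_i.

Definition semialg (P : 'cV[R]_n -> Prop) :=
  exists f, forall e, P (env_col e) <-> ord.holds e f.

Definition polyfun (F : 'cV[R]_n -> R) :=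
  exists t, forall e, F (env_col e) = GRing.eval e t.

Lemma polyfun_const c : polyfun (fun=> c).
Proof. by exists (GRing.Const c). Qed.

Lemma polyfun_coord i : polyfun (fun x => x i 0).
Proof. by exists (GRing.Var R i) => e; rewrite mxE. Qed.

Lemma polyfunD F G : polyfun F -> polyfun G -> polyfun (fun x => F x + G x).
Proof. by case=> t ht [u hu]; exists (GRing.Add t u) => e /=; rewrite ht hu. Qed.

Lemma polyfunN F : polyfun F -> polyfun (fun x => - F x).
Proof. by case=> t ht; exists (GRing.Opp t) => e /=; rewrite ht. Qed.

Lemma polyfunM F G : polyfun F -> polyfun G -> polyfun (fun x => F x * G x).
Proof. by case=> t ht [u hu]; exists (GRing.Mul t u) => e /=; rewrite ht hu. Qed.

Lemma polyfun_sum (F : 'I_n -> 'cV[R]_n -> R) :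
  (forall i, polyfun (F i)) -> polyfun (fun x => \sum_i F i x).
Proof.
move=> hF; elim: (index_enum _) => [|i s [t ht]].
  by exists (GRing.Const 0) => e; rewrite big_nil.
have [u hu] := hF i.
by exists (GRing.Add u t) => e /=; rewrite big_cons ht hu.
Qed.

Lemma semialg_le F G : polyfun F -> polyfun G -> semialg (fun x => F x <= G x).
Proof. by case=> t ht [u hu]; exists (ord.Le t u) => e /=; rewrite ht hu. Qed.

Lemma semialg_eq F G : polyfun F -> polyfun G -> semialg (fun x => F x = G x).
Proof. by case=> t ht [u hu]; exists (ord.Equal t u) => e /=; rewrite ht hu. Qed.

Lemma semialg_and P Q : semialg P -> semialg Q -> semialg (fun x => P x /\ Q x).
Proof. by case=> f hf [g hg]; exists (ord.And f g) => e /=; rewrite hf hg. Qed.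

Lemma semialg_or P Q : semialg P -> semialg Q -> semialg (fun x => P x \/ Q x).
Proof. by case=> f hf [g hg]; exists (ord.Or f g) => e /=; rewrite hf hg. Qed.

Lemma semialg_all (P : 'I_n -> 'cV[R]_n -> Prop) :
  (forall i, semialg (P i)) -> semialg (fun x => forall i, P i x).
Proof.
move=> /fin_all_exists[f hf].
exists (foldr (fun i => ord.And (f i)) ord.True (enum 'I_n)) => e.
suff h s : (forall i, i \in s -> P i (env_col e)) <->
    ord.holds e (foldr (fun i => ord.And (f i)) ord.True s).
  rewrite -h; split=> hP i; first by move=> _; apply: hP.
  by apply: hP; rewrite mem_enum.
elim: s => //= i s IH; rewrite -IH -hf; split=> [h|[h1 h2] j].
  by split=> [|j js]; apply: h; rewrite inE ?eqxx ?js ?orbT.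
by case/predU1P=> [->|/h2].
Qed.

(** Quantifying away all coordinates but the [i]-th defines the projection of [P] to that axis, to
    which [definable_inf] applies. Each coordinate is approached separately; [m] need not satisfy
    [P]. *)
Lemma semialg_inf P : semialg P -> (exists x, P x) ->
  (forall x, P x -> forall i, 0 <= x i 0) ->
  exists m : 'cV[R]_n, (forall x, P x -> forall i, m i 0 <= x i 0) /\
    forall i eps, 0 < eps -> exists x, P x /\ x i 0 < m i 0 + eps.
Proof.
move=> [f hf] [w Pw] P0.
suff /fin_all_exists[m hm] : forall i, exists mi,
    (forall x, P x -> mi <= x i 0) /\
    forall eps, 0 < eps -> exists x, P x /\ x i 0 < mi + eps.
  exists (\col_i m i); split=> [x Px i|i eps eps0]; rewrite mxE.
    exact: (hm i).1.
  exact: (hm i).2.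
move=> i; pose s := [seq j <- iota 0 n | j != i :> nat].
have AP (t : R) : ord.holds (set_nth 0 [::] i t) (foldr ord.Exists f s) <->
    exists x, P x /\ x i 0 = t.
  rewrite holds_foldExists; split=> [[e [he /hf Pe]]|[x [Px xt]]].
    exists (env_col e); split=> //; rewrite mxE he.
      by rewrite nth_set_nth /= eqxx.
    by rewrite mem_filter eqxx.
  (* The length is exactly [n]: an index outside [s] is either [i] or at least [n], where both
     environments return the default 0. *)
  pose e := mkseq (fun j => if insub j is Some k then x k 0 else 0) n.
  have ex : env_col e = x.
    by apply/colP => j; rewrite mxE nth_mkseq // insubT // => lt; congr (x _ _); apply: val_inj.
  exists e; split; last by apply/hf; rewrite ex.
  move=> j; rewrite mem_filter mem_iota /= add0n nth_set_nth /= nth_nil.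
  case: (eqVneq j i) => [-> _|_ /=].
    by rewrite -xt -ex mxE.
  by rewrite -leqNgt => le; rewrite nth_default // size_mkseq.
have [||m [lbm apm]] := @definable_inf [::] i (foldr ord.Exists f s) (w i 0) 0.
- by apply/AP; exists w.
- by move=> t /AP[x [Px <-]]; apply: P0.
exists m; split=> [x Px|eps eps0]; first by apply: lbm; apply/AP; exists x.
by have [t [/AP[x [Px <-]] lt]] := apm eps eps0; exists x.
Qed.

End Semialgebraic.

(** * Solving the balance equations *)

Section Existence.
Variables (R : rcfType) (n : nat).
Implicit Types x y w : 'cV[R]_n.

Definition logistic (a t : R) := a * t * (1 - t).

Lemma logistic_ge0 a t : 0 <= a -> 0 <= t <= 1 -> 0 <= logistic a t.
Proof. by move=> a0 /andP[t0 t1]; rewrite !mulr_ge0 ?subr_ge0. Qed.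

Lemma le_logistic a s t : 0 <= a -> s <= t -> t <= 1/2 -> logistic a s <= logistic a t.
Proof.
move=> a0 st t2; rewrite -subr_ge0.
have -> : logistic a t - logistic a s = a * ((t - s) * (1 - t - s)) by rewrite /logistic; ring.
by apply/mulr_ge0/mulr_ge0; lra.
Qed.

Lemma logistic_le_half a t : 0 <= a -> logistic a t <= logistic a (1/2).
Proof.
move=> a0; rewrite -subr_ge0.
have -> : logistic a (1/2) - logistic a t = a * (t - 1/2) ^+ 2 by rewrite /logistic; field.
by rewrite mulr_ge0 ?sqr_ge0.
Qed.

(** The slope of [logistic a] is at most [a] on nonnegative arguments. This bound sizes the
    perturbations of the infimum in [monotone_system_solution]. *)
Lemma addr_logistic_lipschitz a s t : 0 <= a -> 0 <= s -> s <= t ->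
  t + logistic a t - (s + logistic a s) <= (t - s) * (1 + a).
Proof.
move=> a0 s0 st; rewrite -subr_ge0.
have -> : (t - s) * (1 + a) - (t + logistic a t - (s + logistic a s)) = a * ((t - s) * (s + t)).
  by rewrite /logistic; ring.
by apply/mulr_ge0/mulr_ge0; lra.
Qed.

Lemma polyfun_logistic a (F : 'cV[R]_n -> R) : polyfun F -> polyfun (fun x => logistic a (F x)).
Proof.
move=> hF; apply: polyfunM; first exact: polyfunM (polyfun_const _ _) hF.
exact: polyfunD (polyfun_const _ _) (polyfunN hF).
Qed.

Lemma sum_invn : (0 < n)%N -> \sum_(i < n) n%:R^-1 = 1 :> R.
Proof.
by move=> n0; rewrite sumr_const card_ord -[_^-1 *+ _]mulr_natl divff // pnatr_eq0 -lt0n.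
Qed.

(** Knaster-Tarski argument: [m] is the coordinatewise infimum of the supersolutions, and lies in
    [D] because [D] is closed downwards among nonnegative vectors. Monotonicity makes [m] a
    supersolution, minimality makes it a subsolution. A coordinate equal to 1/2 is exempt from the
    supersolution inequality. *)
Lemma monotone_system_solution (D : 'cV[R]_n -> Prop) (T : 'cV[R]_n -> 'cV[R]_n)
    (a : 'I_n -> R) w :
  (forall i, 0 <= a i) -> semialg D -> (forall i, polyfun (fun x => T x i 0)) ->
  (forall x, D x -> forall i, 0 <= x i 0 <= 1/2) ->
  (forall x y, (forall i, 0 <= x i 0 <= y i 0) -> D y ->
     D x /\ forall i, 0 <= T x i 0 <= T y i 0) ->
  D w -> (forall i, w i 0 = 1/2 \/ T w i 0 <= w i 0 + logistic (a i) (w i 0)) ->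
  exists m, [/\ D m, forall i, m i 0 <= w i 0,
    forall i, m i 0 + logistic (a i) (m i 0) <= T m i 0 &
    forall i, m i 0 = 1/2 \/ m i 0 + logistic (a i) (m i 0) = T m i 0].
Proof.
move=> a0 sD pT Dbox mono Dw supw.
pose P x := D x /\ forall i, x i 0 = 1/2 \/ T x i 0 <= x i 0 + logistic (a i) (x i 0).
have sP : semialg P.
  apply: semialg_and => //; apply: semialg_all => i; apply: semialg_or.
    exact: semialg_eq (polyfun_coord _ _) (polyfun_const _ _).
  apply: semialg_le => //; apply: polyfunD; last apply: polyfun_logistic;
    exact: polyfun_coord.
have P0 x : P x -> forall i, 0 <= x i 0.
  by move=> [/Dbox h _] i; case/andP: (h i).
have [m [lbm apm]] := semialg_inf sP (ex_intro _ w (conj Dw supw)) P0.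
have mw := lbm w (conj Dw supw).
have m0 i : 0 <= m i 0.
  rewrite leNgt; apply/negP => mi; have [|x [Px]] := apm i (- m i 0); first lra.
  by rewrite subrr ltNge (P0 _ Px).
have Dm : D m by case: (mono m w) => // i; rewrite m0 mw.
have T0 x : D x -> forall i, 0 <= T x i 0.
  move=> Dx i; have [|_ h] := mono x x _ Dx; last by case/andP: (h i).
  by move=> j; rewrite lexx; case/andP: (Dbox x Dx j) => ->.
have supm i : m i 0 = 1/2 \/ T m i 0 <= m i 0 + logistic (a i) (m i 0).
  case: (lerP (T m i 0) (m i 0 + logistic (a i) (m i 0))) => [|gap]; first by right.
  case: (ltrP (m i 0) (1/2)) => m2; last first.
    by left; apply/eqP; rewrite eq_le m2; case/andP: (Dbox _ Dm i) => _ ->.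
  exfalso; set g := T m i 0 - (m i 0 + logistic (a i) (m i 0)).
  have g0 : 0 < g by rewrite subr_gt0.
  have ai1 : 0 < 1 + a i by have := a0 i; lra.
  (* The first bound keeps [x i 0] below 1/2, so that [x] satisfies the inequality at [i]; the
     second keeps the growth of [t + logistic (a i) t] below the gap [g]. *)
  pose eps := Num.min (1/2 - m i 0) (g / (1 + a i)).
  have eps0 : 0 < eps by rewrite lt_min divr_gt0 // subr_gt0 m2.
  have [x [[Dx supx] ltx]] := apm i eps eps0.
  have lemx := lbm x (conj Dx supx).
  have e1 : eps <= 1/2 - m i 0 by rewrite /eps ge_min lexx.
  have e2 : eps * (1 + a i) <= g by rewrite -ler_pdivlMr // /eps ge_min lexx orbT.
  have [_ /(_ i)/andP[_ leT]] : D m /\ forall i, 0 <= T m i 0 <= T x i 0.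
    by apply: mono => // j; rewrite m0 lemx.
  case: (supx i) => [xi|hx]; first lra.
  have lip := addr_logistic_lipschitz (a0 i) (m0 i) (lemx i).
  have : (x i 0 - m i 0) * (1 + a i) < eps * (1 + a i) by rewrite ltr_pM2r //; lra.
  by move: e2; rewrite /g; lra.
have subm i : m i 0 + logistic (a i) (m i 0) <= T m i 0.
  rewrite leNgt; apply/negP => gap; set g := m i 0 + logistic (a i) (m i 0) - T m i 0.
  have g0 : 0 < g by rewrite subr_gt0.
  have ai1 : 0 < 1 + a i by have := a0 i; lra.
  have mi0 : 0 < m i 0.
    rewrite lt_neqAle m0 andbT; apply/eqP => mi.
    by have := T0 m Dm i; move: gap; rewrite -mi /logistic; lra.
  (* Lowering coordinate [i] by [d] keeps it nonnegative and costs at most the gap, so [m'] is a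
     supersolution that undercuts the infimum. *)
  pose d := Num.min (m i 0) (g / (1 + a i)).
  have d0 : 0 < d by rewrite lt_min divr_gt0 // mi0.
  have d1 : d <= m i 0 by rewrite /d ge_min lexx.
  have d2 : d * (1 + a i) <= g by rewrite -ler_pdivlMr // /d ge_min lexx orbT.
  pose m' : 'cV[R]_n := \col_j (if j == i then m i 0 - d else m j 0).
  have [Dm' mT] : D m' /\ forall j, 0 <= T m' j 0 <= T m j 0.
    apply: mono => // j; rewrite mxE; case: (eqVneq j i) => [->|_]; last by rewrite m0 lexx.
    by apply/andP; split; lra.
  have Pm' : P m'.
    split=> // j; have /andP[_ leT] := mT j; rewrite !mxE.
    case: (eqVneq j i) leT => [-> leT|ji leT]; last first.
      by case: (supm j) => h; [left|right; apply: le_trans h].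
    right; have le0 : 0 <= m i 0 - d by lra.
    have le1 : m i 0 - d <= m i 0 by lra.
    have := addr_logistic_lipschitz (a0 i) le0 le1; rewrite subKr.
    by move: d2; rewrite /g; lra.
  by have := lbm m' Pm' i; rewrite mxE eqxx; lra.
exists m; split=> // i; case: (supm i) => h; [by left|right].
by apply/eqP; rewrite eq_le subm h.
Qed.

(** The transpose of a row-stochastic matrix preserves totals. This yields the coordinate sum 1 in
    the existence proof and the 1-norm bound in the uniqueness proof. *)
Lemma sumr_logistic_stochastic (C : 'M[R]_n) (u : 'I_n -> R) : row_stochastic C ->
  \sum_i \sum_j C j i * u j = \sum_j u j.
Proof.
case=> _ C1; rewrite exchange_big; apply: eq_bigr => j _.
by rewrite -mulr_suml C1 mul1r.
Qed.

Lemma balance_exists (C : 'M[R]_n) (a : 'I_n -> R) :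
  (0 < n)%N -> row_stochastic C -> (forall i, 0 <= a i) ->
  exists x, in_simplex x /\ forall i, x i 0 + logistic (a i) (x i 0) =
    n%:R^-1 + \sum_j C j i * logistic (a j) (x j 0).
Proof.
move=> n0 hC a0; have [C0 C1] := hC.
have sumn := sum_invn n0.
have ninv0 : 0 <= n%:R^-1 :> R by rewrite invr_ge0 ler0n.
pose S x i := \sum_j C j i * logistic (a j) (x j 0).
have pS i : polyfun (fun x => S x i).
  apply: polyfun_sum => j; apply: polyfunM (polyfun_const _ _) _.
  exact/polyfun_logistic/polyfun_coord.
have S0 x i : (forall j, 0 <= x j 0 <= 1) -> 0 <= S x i.
  by move=> hx; apply: sumr_ge0 => j _; rewrite mulr_ge0 ?logistic_ge0.
have Smono x y i : (forall j, x j 0 <= y j 0 <= 1/2) -> S x i <= S y i.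
  move=> hxy; apply: ler_sum => j _; apply: ler_wpM2l => //.
  by have /andP[? ?] := hxy j; apply: le_logistic.
pose box x := forall i, 0 <= x i 0 /\ x i 0 <= 1/2.
have sbox : semialg box.
  apply: semialg_all => i; apply: semialg_and; apply: semialg_le;
    by [apply: polyfun_coord|apply: polyfun_const].
have boxS x y : (forall i, 0 <= x i 0 <= y i 0) -> box y -> box x.
  by move=> hxy By i; have /andP[? ?] := hxy i; have [? ?] := By i; split; lra.
have box1 x : box x -> forall i, 0 <= x i 0 <= 1.
  by move=> Bx i; have [? ?] := Bx i; apply/andP; split; lra.
have boxD x y : (forall i, 0 <= x i 0 <= y i 0) -> box y -> forall i, 0 <= S x i <= S y i.
  move=> hxy By i; rewrite S0 /=; last exact/box1/(boxS _ y).
  by apply: Smono => j; have /andP[_ ->] := hxy j; have [_ ->] := By j.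
pose T1 x : 'cV[R]_n := \col_i (n%:R^-1 + S x i).
have [|||||m [Bm _ subm eqm]] :=
    @monotone_system_solution box T1 a (const_mx (1/2)) a0 sbox.
- move=> i; have [t ht] := polyfunD (polyfun_const n n%:R^-1) (pS i).
  by exists t => e; rewrite mxE ht.
- by move=> x Bx i; have [-> ->] := Bx i.
- move=> x y hxy By; split; first exact: boxS By.
  by move=> i; rewrite !mxE; have /andP[? ?] := boxD x y hxy By i; apply/andP; split; lra.
- by move=> i; rewrite mxE; split; lra.
- by move=> i; left; rewrite mxE.
(* The right-hand side of the balance at [m], less the logistic term of [m i 0]. It agrees with [m]
   wherever the equation holds, and its total is 1 even if [m] is truncated. *)
pose x : 'cV[R]_n := \col_i (n%:R^-1 + S m i - logistic (a i) (m i 0)).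
have mx i : m i 0 <= x i 0 by have := subm i; rewrite !mxE; lra.
have m0 i : 0 <= m i 0 by case: (Bm i).
have sumx : \sum_i x i 0 = 1.
  under eq_bigr do rewrite mxE.
  by rewrite sumrB big_split /= sumn sumr_logistic_stochastic // addrK.
have [/forallP xm|/forallPn[k xk]] := boolP [forall i, x i 0 == m i 0].
  exists m; split; last first.
    by move=> i; have /eqP := xm i; rewrite mxE /S; lra.
  split=> //; rewrite -sumx; apply: eq_bigr => i _; exact/esym/eqP.
have mk : m k 0 = 1/2.
  case: (eqm k) => // h; case/eqP: xk; move: h; rewrite !mxE; lra.
have {}xk : 1/2 < x k 0 by rewrite -mk lt_neqAle eq_sym xk mx.
(* The share of [k] exceeds 1/2.  Eliminating it through [x k = 1 - s], where [s] is
   the total share of the others, keeps the system monotone, since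
   [logistic (a k) (1 - s) = logistic (a k) s] increases with [s] on [0, 1/2]. *)
pose s y := \sum_i (y : 'cV[R]_n) i 0.
pose D y := box y /\ y k 0 = 0 /\ s y <= 1/2.
pose T2 y : 'cV[R]_n :=
  \col_i (if i == k then 0 else n%:R^-1 + S y i + C k i * logistic (a k) (s y)).
(* [w] is a supersolution for [T2]: its total is at most [1 - x k 0 < 1/2], and the term
   [logistic (a k) (s w)] replacing that of [k] is at most the former [logistic (a k) (1/2)]. *)
pose w : 'cV[R]_n := \col_i (if i == k then 0 else m i 0).
have ps : polyfun s by apply: polyfun_sum => i; apply: polyfun_coord.
have Dbox y : D y -> box y by case.
have sw : s w < 1/2.
  have : s w <= 1 - x k 0.
    rewrite -sumx (bigD1 k) //= addrC addrK /s (bigD1 k) //= mxE eqxx add0r.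
    by apply: ler_sum => i ik; rewrite mxE (negPf ik).
  lra.
have Bw : box w.
  by move=> i; rewrite mxE; case: ifP => // _; split; lra.
have [||||||z [Dz zw _ eqz]] := @monotone_system_solution D T2 a w a0.
- apply: semialg_and sbox _; apply: semialg_and.
    exact: semialg_eq (polyfun_coord _ _) (polyfun_const _ _).
  exact: semialg_le ps (polyfun_const _ _).
- move=> i; case: (eqVneq i k) => [->|ik].
    by exists (GRing.Const 0) => e; rewrite mxE eqxx.
  have [t ht] := polyfunD (polyfunD (polyfun_const n n%:R^-1) (pS i))
     (polyfunM (polyfun_const n (C k i)) (polyfun_logistic (a k) ps)).
  by exists t => e; rewrite mxE (negPf ik) ht.
- by move=> y [By _] i; have [-> ->] := By i.
- move=> y y' hy [By [yk sy]].
  have lesy : s y <= s y' by apply: ler_sum => i _; have /andP[] := hy i.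
  have s0 : 0 <= s y by apply: sumr_ge0 => i _; have /andP[] := hy i.
  split.
    split; first exact: boxS By.
    split; last exact: le_trans sy.
    by apply/eqP; rewrite eq_le; have := hy k; rewrite yk => /andP[-> ->].
  move=> i; rewrite !mxE; case: ifP => // _; first by rewrite lexx.
  have /andP[S1 S2] := boxD y y' hy By i.
  have b1 : 0 <= C k i * logistic (a k) (s y).
    by rewrite mulr_ge0 ?logistic_ge0 //; apply/andP; split; lra.
  have b2 : C k i * logistic (a k) (s y) <= C k i * logistic (a k) (s y').
    by rewrite ler_wpM2l // le_logistic.
  by apply/andP; split; lra.
- by split=> //; split; [rewrite mxE eqxx|lra].
- move=> i; rewrite !mxE; case: (eqVneq i k) => [_|ik].
    by right; rewrite /logistic mulr0 mul0r addr0.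
  case: (eqm i) => [?|]; first by left.
  rewrite mxE => ->; right; rewrite -addrA lerD2l.
  rewrite /S (bigD1 k) //= [leRHS](bigD1 k) //= mk mxE eqxx.
  rewrite {1}/logistic mulr0 mul0r mulr0 add0r addrC lerD //.
    by rewrite ler_wpM2l // logistic_le_half.
  by apply: ler_sum => j jk; rewrite mxE (negPf jk).
have [Bz [zk _]] := Dz.
have sz : s z < 1/2 by apply: le_lt_trans sw; apply: ler_sum => i _.
have z0 i : 0 <= z i 0 by case: (Bz i).
have szk : s z = \sum_(i | i != k) z i 0 by rewrite /s (bigD1 k) //= zk add0r.
(* No coordinate of [z] is truncated, since already their total is below 1/2. *)
have zlt i : i != k -> z i 0 < 1/2.
  move=> ik; apply: le_lt_trans sz; rewrite /s (bigD1 i) //= lerDl.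
  exact: sumr_ge0.
pose u : 'cV[R]_n := \col_i (if i == k then 1 - s z else z i 0).
have uk : u k 0 = 1 - s z by rewrite mxE eqxx.
have ui i : i != k -> u i 0 = z i 0 by move=> ik; rewrite mxE (negPf ik).
have su : \sum_i u i 0 = 1.
  by rewrite (bigD1 k) //= uk (eq_bigr (fun i => z i 0)) // -szk subrK.
have equ i : i != k -> u i 0 + logistic (a i) (u i 0) = n%:R^-1 + S u i.
  move=> ik; rewrite ui //; case: (eqz i) => [zi|]; first by have := zlt i ik; lra.
  rewrite mxE (negPf ik) => ->; rewrite /S (bigD1 k) //= [in RHS](bigD1 k) //= uk zk.
  rewrite (eq_bigr (fun j => C j i * logistic (a j) (u j 0))); last first.
    by move=> j jk; rewrite ui.
  by rewrite /logistic; ring.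
exists u; split.
  split=> // i; case: (eqVneq i k) => [->|ik]; last by rewrite ui.
  by rewrite uk; lra.
move=> i; case: (eqVneq i k) => [->|]; last exact: equ.
(* The equation at [k] is what remains of the summed equations once those at the other indices are
   removed. *)
have : \sum_i (u i 0 + logistic (a i) (u i 0)) = \sum_i (n%:R^-1 + S u i).
  by rewrite !big_split /= su sumn sumr_logistic_stochastic.
rewrite (bigD1 k) //= [RHS](bigD1 k) //= (eq_bigr _ equ).
exact: addIr.
Qed.

End Existence.

(** * Equilibria of both systems as solutions of the balance equations *)

Section Equilibria.
Variables (R : rcfType) (n : nat) (C : 'M[R]_n) (theta : 'I_n -> R).
Hypothesis hC : row_stochastic C.
Hypothesis theta0 : forall i, 0 <= theta i.
Hypothesis theta1 : forall i, theta i < 1.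
Implicit Types x y : 'cV[R]_n.

Lemma simplex_le1 x : in_simplex x -> forall i, x i 0 <= 1.
Proof. by case=> x0 <- i; rewrite (bigD1 i) //= lerDl sumr_ge0. Qed.

Lemma WmxE x i j : Wmx C x i j = x i 0 *+ (i == j) + (1 - x i 0) * C i j.
Proof.
rewrite /Wmx mulmxBl mul1mx mul_diag_mx !mxE.
by rewrite mulrBl mul1r.
Qed.

Lemma Wmx_row_stochastic x : in_simplex x -> row_stochastic (Wmx C x).
Proof.
move=> sx; have [x0 _] := sx; have [C0 C1] := hC; split=> [i j|i].
  by rewrite WmxE addr_ge0 ?mulrn_wge0 ?mulr_ge0 ?subr_ge0 ?simplex_le1.
under eq_bigr do rewrite WmxE.
rewrite big_split /= -mulr_sumr C1 mulr1 (bigD1 i) //= eqxx big1 ?addr0 ?subrKC //.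
by move=> j ji; rewrite eq_sym (negPf ji).
Qed.

(* Minimum principle: at a minimal entry [v i < 0] the hypothesis would give
   [v i >= theta i * v i > v i]. *)
Lemma substochastic_min (W : 'M[R]_n) (v : 'I_n -> R) : row_stochastic W ->
  (forall i, theta i * (\sum_j W i j * v j) <= v i) -> forall i, 0 <= v i.
Proof.
move=> [W0 W1] hv i.
case: (arg_minP v (erefl : xpredT i)) => k _ mink.
apply: (le_trans _ (mink i isT)).
have hk : theta k * v k <= v k.
  apply: le_trans (hv k); apply: ler_wpM2l => //.
  rewrite -[leLHS]mul1r -(W1 k) mulr_suml; apply: ler_sum => j _.
  by rewrite ler_wpM2l // mink.
have : 0 <= (1 - theta k) * v k by rewrite mulrBl mul1r subr_ge0.
by rewrite pmulr_rge0 // subr_gt0.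
Qed.

(** Its transpose is the matrix inverted in [Fmap], and the equation for [V] in (B) reads
    [resolvent x *m V = 1%:M - Theta theta]. *)
Definition resolvent x := 1%:M - Theta theta *m Wmx C x.

Lemma resolventE x p (V : 'M[R]_(n, p)) i j : (resolvent x *m V) i j =
  V i j - theta i * \sum_k Wmx C x i k * V k j.
Proof.
by rewrite /resolvent mulmxBl mul1mx -mulmxA /Theta mul_diag_mx !mxE.
Qed.

(** The minimum principle applies to a kernel vector and to its opposite, so the vector is 0. *)
Lemma resolvent_unit x : in_simplex x -> resolvent x \in unitmx.
Proof.
move=> sx; rewrite -unitmx_tr unitmxE unitfE; apply/negP => /det0P[v v0 hv].
case/eqP: v0; have {hv} : resolvent x *m v^T = 0.
  by apply: trmx_inj; rewrite trmx_mul trmxK hv trmx0.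
rewrite /resolvent mulmxBl mul1mx -mulmxA => /eqP; rewrite subr_eq0 => /eqP hv.
have sW := Wmx_row_stochastic sx.
have hvi i : v 0 i = theta i * \sum_j Wmx C x i j * v 0 j.
  have /colP/(_ i) := hv; rewrite /Theta mul_diag_mx mxE [RHS]mxE mxE [X in _ * X]mxE => ->.
  by congr (_ * _); apply: eq_bigr => j _; congr (_ * _); rewrite mxE.
apply/rowP => i; rewrite mxE; apply/eqP; rewrite eq_le; apply/andP; split.
  rewrite -oppr_ge0; apply: (substochastic_min (v := fun i => - v 0 i) sW) => j.
  by under eq_bigr do rewrite mulrN; rewrite sumrN mulrN -hvi.
by apply: (substochastic_min (v := fun i => v 0 i) sW) => j; rewrite -hvi.
Qed.

Lemma FmapE x :
  Fmap C theta x = (1%:M - Theta theta) *m invmx (resolvent x)^T *m unif R n.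
Proof.
by rewrite /Fmap /resolvent linearB /= trmx1 trmx_mul /Theta tr_diag_mx.
Qed.

Definition odds i := theta i / (1 - theta i).

Lemma odds_ge0 i : 0 <= odds i.
Proof. by rewrite divr_ge0 // subr_ge0 ltW. Qed.

(** Dividing by [1 - theta j] undoes the left factor of [Fmap]. The diagonal part rests on [t * (1 -
    theta i * t) / (1 - theta i) = t + logistic (odds i) t]. *)
Lemma tr_resolvent_mul x i :
  ((resolvent x)^T *m \col_j (x j 0 / (1 - theta j))) i 0 =
  x i 0 + logistic (odds i) (x i 0) - \sum_j C j i * logistic (odds j) (x j 0).
Proof.
have nz j : 1 - theta j != 0 by rewrite subr_eq0 eq_sym lt_eqF.
rewrite /resolvent linearB /= trmx1 mulmxBl mul1mx trmx_mul /Theta tr_diag_mx.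
rewrite -mulmxA mul_diag_mx !mxE.
under [X in _ - X = _]eq_bigr => j _ do rewrite [_^T i j]mxE WmxE mulrDl mulrnAl !mxE.
rewrite big_split /= opprD addrA; congr (_ - _).
  rewrite (bigD1 i) //= eqxx big1 ?addr0; last by move=> j /negPf->.
  by rewrite mulr1n /odds /logistic; field.
by apply: eq_bigr => j _; rewrite /odds /logistic; field.
Qed.

Lemma equilibriumA_balance x : equilibriumA C theta x <->
  in_simplex x /\ forall i, x i 0 + logistic (odds i) (x i 0) =
    n%:R^-1 + \sum_j C j i * logistic (odds j) (x j 0).
Proof.
have nz j : 1 - theta j != 0 by rewrite subr_eq0 eq_sym lt_eqF.
have diagE y : (1%:M - Theta theta) *m y = \col_i ((1 - theta i) * y i 0).
  apply/colP => i; rewrite mulmxBl mul1mx /Theta mul_diag_mx !mxE; ring.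
split=> -[sx hx]; split=> //.
  move=> i; apply/eqP; rewrite -subr_eq -tr_resolvent_mul.
  suff -> : \col_j (x j 0 / (1 - theta j)) = invmx (resolvent x)^T *m unif R n.
    by rewrite mulKVmx ?mxE // unitmx_tr resolvent_unit.
  apply/colP => j; rewrite -{1}hx FmapE -mulmxA diagE !mxE.
  by rewrite mulrAC mulfV ?mul1r.
rewrite FmapE -mulmxA.
have -> : unif R n = (resolvent x)^T *m \col_j (x j 0 / (1 - theta j)).
  by apply/colP => i; rewrite tr_resolvent_mul hx addrK mxE.
rewrite mulKmx ?unitmx_tr ?resolvent_unit // diagE.
by apply/colP => i; rewrite !mxE mulrC divfK.
Qed.

(** For [x] in the simplex the equation for [V] has exactly one solution, and its column averages
    form [Fmap C theta x]; it remains to see that this solution is row-stochastic. *)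
Lemma equilibriumA_B x :
  equilibriumA C theta x <-> exists V, equilibriumB C theta V x.
Proof.
have VP (V : 'M[R]_n) : V = Theta theta *m Wmx C x *m V + 1%:M - Theta theta <->
    resolvent x *m V = 1%:M - Theta theta.
  rewrite /resolvent mulmxBl mul1mx; move: (_ *m V) => X; rewrite -addrA.
  split=> [->|<-]; first by rewrite [LHS]addrC addKr.
  by rewrite [RHS]addrC subrK.
have FV (V : 'M[R]_n) : in_simplex x -> resolvent x *m V = 1%:M - Theta theta ->
    V^T *m unif R n = Fmap C theta x.
  move=> sx hV; rewrite FmapE -trmx_inv; congr (_ *m _).
  rewrite -(mulKmx (resolvent_unit sx) V) hV trmx_mul linearB /= trmx1.
  by rewrite /Theta tr_diag_mx.
split=> [[sx hx]|[V [_ [sx [/VP hV hx]]]]]; last first.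
  by split=> //; rewrite -(FV V).
have sW := Wmx_row_stochastic sx.
pose V := invmx (resolvent x) *m (1%:M - Theta theta).
have hV : resolvent x *m V = 1%:M - Theta theta.
  by rewrite mulKVmx // resolvent_unit.
exists V; split; last by split=> //; split; [apply/VP|rewrite (FV V)].
split=> [i j|i].
  (* Minimum principle on column [j], as [1%:M - Theta theta] has nonnegative entries. *)
  apply: (substochastic_min (v := fun i => V i j) sW) => k.
  rewrite -subr_ge0 -resolventE hV /Theta !mxE; case: (eqVneq k j) => _.
    by rewrite !mulr1n subr_ge0 ltW.
  by rewrite subrr.
(* Since [Wmx C x] fixes the all-ones vector, [resolvent x] and [1%:M - Theta theta] act on it
   alike. *)
have : V *m const_mx 1 = const_mx 1 :> 'cV[R]_n.
  rewrite -mulmxA; apply: canLR (mulKmx (resolvent_unit sx)) _.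
  apply/colP => k; rewrite resolventE mulmxBl mul1mx /Theta mul_diag_mx.
  have [_ W1] := sW; have -> : \sum_j Wmx C x k j * (const_mx 1 : 'cV[R]_n) j 0 = 1.
    by rewrite -[RHS](W1 k); apply: eq_bigr => j _; rewrite [const_mx _ _ _]mxE mulr1.
  by rewrite !mxE.
move=> /colP/(_ i); rewrite [RHS]mxE mxE => <-.
by apply: eq_bigr => j _; rewrite [const_mx _ _ _]mxE mulr1.
Qed.

Hypothesis n2 : (2 <= n)%N.

Lemma equilibriumA_exists : exists x, equilibriumA C theta x.
Proof.
have [|x hx] := balance_exists _ hC odds_ge0; first exact: ltnW n2.
by exists x; apply/equilibriumA_balance.
Qed.

(** * Bounds on the equilibrium social power *)

Section Equilibrium.
Variable x : 'cV[R]_n.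
Hypothesis eqx : equilibriumA C theta x.

Let sx : in_simplex x. Proof. by case: eqx. Qed.
Let x01 i : 0 <= x i 0 <= 1.
Proof. by rewrite simplex_le1 // andbT; case: sx. Qed.
Let invn_gt0 : 0 < n%:R^-1 :> R. Proof. by rewrite invr_gt0 ltr0n ltnW. Qed.
Let term_ge0 i j : 0 <= C j i * logistic (odds j) (x j 0).
Proof. by have [C0 _] := hC; rewrite mulr_ge0 ?logistic_ge0 ?odds_ge0. Qed.
Let balance i : x i 0 + logistic (odds i) (x i 0) =
    n%:R^-1 + \sum_j C j i * logistic (odds j) (x j 0).
Proof. by have [_] := (equilibriumA_balance x).1 eqx; apply. Qed.

(** The balance equation times [1 - theta i], with its nonnegative sum dropped. Positivity and the
    lower bound in (c) both follow from it. *)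
Lemma equilibrium_ge i : (1 - theta i) / n%:R <= x i 0 * (1 - theta i * x i 0).
Proof.
have nz : 1 - theta i != 0 by rewrite subr_eq0 eq_sym lt_eqF.
have -> : x i 0 * (1 - theta i * x i 0) = (1 - theta i) * (x i 0 + logistic (odds i) (x i 0)).
  by rewrite /logistic /odds; field.
apply: ler_wpM2l; first by rewrite subr_ge0 ltW.
by rewrite balance lerDl; apply: sumr_ge0.
Qed.

Lemma equilibrium_gt0 i : 0 < x i 0.
Proof.
have /andP[x0 _] := x01 i; rewrite lt_neqAle x0 andbT; apply/eqP => xi0.
have := equilibrium_ge i; rewrite -xi0 mul0r leNgt.
by rewrite mulr_gt0 // subr_gt0.
Qed.

(** Another coordinate exists because [n >= 2], and it is positive. Strictness makes
    [logistic (odds j) (x j 0)] vanish only when [theta j = 0], on which the equality case in (b)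
    rests. *)
Lemma equilibrium_lt1 i : x i 0 < 1.
Proof.
have [k ki] : exists k : 'I_n, k != i.
  pose k0 := Ordinal (ltnW n2); pose k1 := Ordinal n2.
  by case: (eqVneq k0 i) => [<-|]; [exists k1|exists k0].
have [_ <-] := sx; rewrite (bigD1 i) //= ltrDl (bigD1 k) //=.
rewrite ltr_wpDr ?equilibrium_gt0 //.
by apply: sumr_ge0 => j _; have /andP[] := x01 j.
Qed.

Lemma logistic_odds_gt0 i : 0 < theta i -> 0 < logistic (odds i) (x i 0).
Proof.
move=> ti; have := equilibrium_lt1 i; have := equilibrium_gt0 i => ? ?.
by rewrite !mulr_gt0 ?invr_gt0 ?subr_gt0.
Qed.

Lemma logistic_odds_eq0 i : theta i = 0 -> logistic (odds i) (x i 0) = 0.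
Proof. by rewrite /logistic /odds => ->; rewrite !mul0r. Qed.

Lemma sum_eq0P i : \sum_j C j i * logistic (odds j) (x j 0) = 0 <->
  forall j, 0 < theta j -> C j i = 0.
Proof.
split=> [h0 j tj|h].
  move/eqP: h0; rewrite psumr_eq0 // => /allP/(_ j (mem_index_enum j)).
  by rewrite /= mulf_eq0 (gt_eqF (logistic_odds_gt0 tj)) orbF => /eqP.
apply: big1 => j _; case: (ltrP 0 (theta j)) => tj; first by rewrite h ?mul0r.
by rewrite logistic_odds_eq0 ?mulr0 //; apply/eqP; rewrite eq_le tj theta0.
Qed.

Lemma equilibrium_stubborn i : theta i = 0 ->
  n%:R^-1 <= x i 0 /\ (x i 0 = n%:R^-1 <-> forall j, 0 < theta j -> C j i = 0).
Proof.
move=> ti; have := balance i; rewrite logistic_odds_eq0 // addr0 => ->; split.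
  by rewrite lerDl; apply: sumr_ge0.
rewrite -sum_eq0P; split=> [/eqP|->]; last exact: addr0.
by rewrite -subr_eq0 addrC addKr => /eqP.
Qed.

Lemma equilibrium_partial i : 0 < theta i -> (1 - theta i) / n%:R < x i 0.
Proof.
move=> ti; apply: le_lt_trans (equilibrium_ge i) _; have := equilibrium_gt0 i => xi.
by rewrite gtr_pMr // gtrBl mulr_gt0.
Qed.

Lemma equilibrium_isolated i : 0 < theta i -> (forall j, 0 < theta j -> C j i = 0) ->
  x i 0 < n%:R^-1.
Proof.
move=> ti /sum_eq0P h; have := balance i; rewrite h addr0 => <-.
by rewrite ltrDl logistic_odds_gt0.
Qed.

Lemma equilibrium_lower i : (1 - theta i) / n%:R <= x i 0.
Proof.
have := theta0 i; rewrite le_eqVlt => /predU1P[ti|ti]; last exact/ltW/equilibrium_partial.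
by rewrite -ti subr0 mul1r; case: (equilibrium_stubborn (esym ti)).
Qed.

Lemma sum_lower i : \sum_(j | j != i) (1 - theta j) / n%:R =
  1 - n%:R^-1 - theta_ave theta + theta i / n%:R.
Proof.
have : \sum_j (1 - theta j) / n%:R = 1 - theta_ave theta.
  under eq_bigr do rewrite mulrBl mul1r.
  by rewrite sumrB sum_invn ?(ltnW n2) // -mulr_suml mulrC.
rewrite (bigD1 i) //= => h; rewrite -[LHS](addKr ((1 - theta i) / n%:R)) h.
ring.
Qed.

(** The lower bounds on the other coordinates leave at most this much for [i]. The term in [theta i]
    is kept because it produces [theta_min] in the uniqueness threshold. *)
Lemma equilibrium_le i : x i 0 <= n%:R^-1 + theta_ave theta - theta i / n%:R.
Proof.
have [_ sum1] := sx; move: sum1; rewrite (bigD1 i) //=.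
have : \sum_(j | j != i) (1 - theta j) / n%:R <= \sum_(j | j != i) x j 0.
  by apply: ler_sum => j _; apply: equilibrium_lower.
rewrite sum_lower; lra.
Qed.

Lemma equilibrium_lt i : (exists j, 0 < theta j) -> x i 0 < n%:R^-1 + theta_ave theta.
Proof.
(* A witness [k = i] makes the subtracted [theta i / n%:R] positive; otherwise the lower bound on
   coordinate [k] is strict. *)
case=> k tk; case: (eqVneq k i) => [ki|ki].
  apply: le_lt_trans (equilibrium_le i) _.
  by rewrite gtrBl -ki mulr_gt0.
have [_ sum1] := sx; move: sum1; rewrite (bigD1 i) //=.
have : \sum_(j | j != i) (1 - theta j) / n%:R < \sum_(j | j != i) x j 0.
  rewrite (bigD1 k) //= [ltRHS](bigD1 k) //= ltr_leD ?equilibrium_partial //.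
  by apply: ler_sum => j _; apply: equilibrium_lower.
have : 0 <= theta i / n%:R by rewrite divr_ge0.
by rewrite sum_lower; lra.
Qed.

End Equilibrium.

(** * Uniqueness of the equilibrium *)

Lemma theta_min_le i : theta_min theta <= theta i.
Proof. by rewrite /theta_min (bigD1 i) //= ge_min lexx. Qed.

Lemma theta_max_ge i : theta i <= theta_max theta.
Proof. by rewrite /theta_max (bigD1 i) //= le_max lexx. Qed.

(* In terms of [d i = odds i * (1 - x i - y i)] the difference [delta = x - y] satisfies
   [(1 + d i) * delta i = \sum_j C j i * d j * delta j].  When all [d i > -1/2], taking
   1-norms gives [\sum_i (|1 + d i| - |d i|) * |delta i| <= 0] with positive coefficients. *)
Lemma equilibriumA_unique x y :
  (forall i, theta i * (2 * (x i 0 + y i 0) - 1) < 1) ->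
  equilibriumA C theta x -> equilibriumA C theta y -> x = y.
Proof.
move=> hxy /equilibriumA_balance[_ bx] /equilibriumA_balance[_ by_].
pose d i := odds i * (1 - x i 0 - y i 0); pose del i := x i 0 - y i 0.
have [C0 _] := hC.
(* This is [hxy] divided by [1 - theta i]. *)
have dgt i : - (1/2) < d i.
  have t1 : 0 < 1 - theta i by rewrite subr_gt0.
  rewrite /d /odds mulrAC ltr_pdivlMr //; have := hxy i; lra.
have deq i : (1 + d i) * del i = \sum_j C j i * (d j * del j).
  have h t s a : t + logistic a t - (s + logistic a s) = (1 + a * (1 - t - s)) * (t - s).
    by rewrite /logistic; ring.
  rewrite /d /del -h bx by_ opprD addrACA subrr add0r -sumrB; apply: eq_bigr => j _.
  by rewrite -mulrBr /logistic; congr (_ * _); ring.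
have le : \sum_i `|1 + d i| * `|del i| <= \sum_i `|d i| * `|del i|.
  rewrite -(sumr_logistic_stochastic (fun i => `|d i| * `|del i|) hC).
  apply: ler_sum => i _; rewrite -normrM deq; apply: le_trans (ler_norm_sum _ _ _) _.
  by apply: ler_sum => j _; rewrite !normrM (ger0_norm (C0 j i)).
have dn i : `|d i| < `|1 + d i|.
  have := dgt i; have -> : `|1 + d i| = 1 + d i by rewrite ger0_norm //; have := dgt i; lra.
  by rewrite ltr_norml => ?; apply/andP; split; lra.
have coef_ge0 i : 0 <= (`|1 + d i| - `|d i|) * `|del i|.
  by rewrite mulr_ge0 // subr_ge0 ltW.
have sum0 : \sum_i (`|1 + d i| - `|d i|) * `|del i| = 0.
  apply/eqP; rewrite eq_le sumr_ge0 // andbT.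
  by under eq_bigr do rewrite mulrBl; rewrite sumrB subr_le0.
apply/colP => i; apply/eqP; rewrite -subr_eq0 -/(del i) -normr_eq0.
have /eqP := sum0; rewrite psumr_eq0 // => /allP/(_ i (mem_index_enum i)).
by rewrite /= mulf_eq0 subr_eq0 gt_eqF.
Qed.

Lemma equilibriumA_unique_small x y :
  theta_max theta <
     n%:R / (n%:R + 2 * (1 + (n%:R * theta_ave theta - theta_min theta))) ->
  equilibriumA C theta x -> equilibriumA C theta y -> x = y.
Proof.
move=> small eqx eqy.
have nz : n%:R != 0 :> R by rewrite pnatr_eq0 -lt0n ltnW.
have n0 : 0 < n%:R :> R by rewrite ltr0n ltnW.
have ave : n%:R * theta_ave theta = \sum_i theta i by rewrite /theta_ave mulVKf.
set zeta := _ - theta_min theta in small.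
(* [kappa] bounds every coordinate of every equilibrium, and [small] amounts to [hmax] because
   [n + 2 (1 + zeta) = n (1 + 2 kappa)]. *)
pose kappa := (1 + zeta) / n%:R.
have kle z i : equilibriumA C theta z -> z i 0 <= kappa.
  move=> /equilibrium_le/(_ i) h; apply: le_trans h _.
  rewrite /kappa ler_pdivlMr // /zeta.
  have -> : (n%:R^-1 + theta_ave theta - theta i / n%:R) * n%:R =
    1 + n%:R * theta_ave theta - theta i by field.
  have := theta_min_le i; lra.
have kappa0 : 0 <= kappa.
  pose i0 := Ordinal (ltnW n2).
  exact: le_trans (ltW (equilibrium_gt0 eqx i0)) (kle _ _ eqx).
have hmax : theta_max theta * (1 + 2 * kappa) < 1.
  have e : n%:R + 2 * (1 + zeta) = n%:R * (1 + 2 * kappa) by rewrite /kappa; field.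
  have k1 : 0 < 1 + 2 * kappa by lra.
  by rewrite -ltr_pdivlMr // div1r; move: small; rewrite e invfM mulVKf.
apply: (equilibriumA_unique _ eqx eqy) => i; apply: le_lt_trans hmax.
(* Only [x i 0] is bounded by [kappa]; for [y i 0] the bound 1 suffices. *)
apply: (@le_trans _ _ (theta i * (1 + 2 * kappa))).
  apply: ler_wpM2l => //.
  have := kle x i eqx; have [sy _] := eqy; have := simplex_le1 sy i; lra.
by apply: ler_wpM2r; [lra|apply: theta_max_ge].
Qed.

End Equilibria.

Theorem theorem1 (R : rcfType) (n : nat) (C : 'M[R]_n) (theta : 'I_n -> R)
  (hn : (2 <= n)%N)
  (hC : row_stochastic C) (hCd : zero_diag C)
  (htheta0 : forall i, 0 <= theta i) (htheta1 : forall i, theta i < 1)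
  (hpos : exists j, 0 < theta j) :
  (* (i) existence, equivalence of equilibrium notions, properties (a)-(d) *)
  ((exists x, equilibriumA C theta x) /\
   (exists V x, equilibriumB C theta V x) /\
   (forall x, equilibriumA C theta x <-> exists V, equilibriumB C theta V x) /\
   (forall x, equilibriumA C theta x ->
      in_int_simplex x /\
      (forall i, theta i = 0 ->
         n%:R^-1 <= x i 0 /\
         (x i 0 = n%:R^-1 <-> forall j, 0 < theta j -> C j i = 0)) /\
      (forall i, 0 < theta i ->
         (1 - theta i) / n%:R < x i 0 /\
         ((forall j, 0 < theta j -> C j i = 0) -> x i 0 < n%:R^-1)) /\
      (forall i, x i 0 < n%:R^-1 + theta_ave theta))) /\
  (* (ii) uniqueness *)
  (theta_max theta <
     n%:R / (n%:R + 2 * (1 + (n%:R * theta_ave theta - theta_min theta))) ->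
   forall x y, equilibriumA C theta x -> equilibriumA C theta y -> x = y).
Proof.
have existsA := equilibriumA_exists hC htheta0 htheta1 hn.
have AB := equilibriumA_B hC htheta0 htheta1.
split; last by move=> small x y; apply: equilibriumA_unique_small.
split=> //; split; first by have [x /AB[V VB]] := existsA; exists V, x.
split=> // x eqx; have [[_ sumx] _] := eqx; split.
  by split=> // i; apply: (equilibrium_gt0 hC htheta0 htheta1 hn eqx).
split; first exact: (equilibrium_stubborn hC htheta0 htheta1 hn eqx).
split=> i; last exact: (equilibrium_lt hC htheta0 htheta1 hn eqx).
move=> ti; split; first exact: (equilibrium_partial hC htheta0 htheta1 hn eqx).
exact: (equilibrium_isolated hC htheta0 htheta1 hn eqx).
Qed.
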